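(* For every finite group $G$, $$P_3(G)=\frac{1}{|G|^3}\sum_{x\in G}|C_G(x)|\,k(C_G(x))=\frac{1}{|G|^2}\sum_{[g]\subseteq G}k(C_G(g)),$$ where the last sum runs over the conjugacy classes $[g]$ of $G$. Equivalently, $$|G|^2P_3(G)=\kappa_2(G)=\sum_{[g]}k(C_G(g)).$$
   Context: For a finite group $G$ and $r\ge 1$, $\mathrm{Comm}_r(G):=\{(x_1,\dots,x_r)\in G^r : x_ix_j=x_jx_i\ \text{for all } i,j\}$ and $P_r(G):=|\mathrm{Comm}_r(G)|/|G|^r$. $\kappa_r(G)$ is the number of orbits of $G$ acting on $\mathrm{Comm}_r(G)$ by simultaneous (diagonal) conjugation. $k(H)$ is the number of conjugacy classes of a finite group $H$, and $C_G(x)$ is the centralizer of $x$ in $G$. *)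

(* Defs.v *)
From mathcomp Require Import all_boot all_order all_algebra all_fingroup all_solvable.

Set Implicit Arguments.
Unset Strict Implicit.
Unset Printing Implicit Defensive.

Import GroupScope GRing.Theory.

Definition Comm (gT : finGroupType) (r : nat) (G : {set gT}) :
    {set r.-tuple gT} :=
  [set t : r.-tuple gT |
    [forall i, tnth t i \in G] &&
    [forall i, forall j, tnth t i * tnth t j == tnth t j * tnth t i]].

Definition comm_prob (gT : finGroupType) (r : nat) (G : {set gT}) : rat :=
  (#|Comm r G|%:R / #|G|%:R ^+ r)%R.

(* ['J * r] is the library's componentwise extension of the conjugation
   action ['J] to r-tuples, i.e. simultaneous conjugation. *)
Definition kappa (gT : finGroupType) (r : nat) (G : {set gT}) : nat :=
  #|orbit ('J * r) G @: Comm r G|.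

(* Main.v *)
Require Import Defs.
From mathcomp Require Import all_boot all_order all_algebra all_fingroup all_solvable.

(** Counting commuting triples by their first entry [x] leaves a commuting pair
    in the centralizer of [x], and counting commuting pairs of a group [H] by
    their first entry leaves an element of a centralizer in [H].  Burnside's
    orbit-counting lemma for [H] acting on itself by conjugation turns the
    latter sum into [|H| k(H)] ([card_Comm2]), which gives the first formula.

    The summand [|C_G(x)| k(C_G(x))] depends only on the class of [x], and that
    class has [|G| / |C_G(x)|] elements; summing class by class therefore
    cancels the factor [|C_G(x)|] and leaves [|G|] times the sum of [k] over
    representatives ([card_Comm3_classes]).

    The link with [kappa] holds for every [r] ([card_Comm_kappa]): a tuple of
    [Comm r G] is fixed by conjugation by [x] exactly when its entries lie in
    the centralizer of [x], so Burnside's lemma counts [kappa r G * |G|] by the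
    same sum that counts [Comm r.+1 G] by first entry. *)

Set Implicit Arguments.
Unset Strict Implicit.
Unset Printing Implicit Defensive.

Import GroupScope GRing.Theory.

Section CommutingTuples.

Variable gT : finGroupType.
Implicit Types (G : {group gT}) (A : {set gT}) (x : gT) (r : nat).

Lemma CommP r A (t : r.-tuple gT) :
  reflect ((forall i, tnth t i \in A) /\
           (forall i j, commute (tnth t i) (tnth t j)))
          (t \in Comm r A).
Proof.
rewrite inE; apply: (iffP andP) => -[tA tC]; split.
- exact/forallP.
- by move=> i j; apply/eqP; move/forallP/(_ i)/forallP: tC.
- exact/forallP.
- by apply/forallP=> i; apply/forallP=> j; apply/eqP/tC.
Qed.

Lemma mem_Comm_cons r A x (t : r.-tuple gT) :
  ([tuple of x :: t] \in Comm r.+1 A) = (x \in A) && (t \in Comm r 'C_A[x]).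
Proof.
apply/CommP/andP => [[xtA xtC] | [xA /CommP[tA tC]]].
  have tE i : tnth [tuple of x :: t] (lift ord0 i) = tnth t i by rewrite tnthS.
  split; first by have := xtA ord0; rewrite tnth0.
  apply/CommP; split=> [i | i j]; last by rewrite -!tE.
  rewrite inE -tE xtA; apply/cent1P.
  by have := xtC ord0 (lift ord0 i); rewrite tnth0.
have tCx i : commute x (tnth t i) by case/setIP: (tA i) => _ /cent1P.
split=> [i | i j].
  by case: (unliftP ord0 i) => [k|] ->; rewrite ?tnth0 // tnthS; case/setIP: (tA k).
case: (unliftP ord0 i) => [k|] ->; case: (unliftP ord0 j) => [l|] ->;
  by rewrite ?tnth0 ?tnthS //; apply: commute_sym.
Qed.

Lemma card_CommS r A :
  #|Comm r.+1 A| = (\sum_(x in A) #|Comm r 'C_A[x]|)%N.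
Proof.
rewrite -sum1_card.
rewrite (reindex (fun p : gT * r.-tuple gT => [tuple of p.1 :: p.2])) /=; last first.
  exists (fun t : r.+1.-tuple gT => (thead t, [tuple of behead t])) => [[x t] _ | t _] /=.
    by congr (_, _); apply: val_inj.
  by rewrite -tuple_eta.
under eq_bigl => p do rewrite mem_Comm_cons.
under [RHS]eq_bigr => x _ do rewrite -sum1_card.
by rewrite pair_big_dep.
Qed.

Lemma card_Comm1 A : #|Comm 1 A| = #|A|.
Proof.
have Comm0 (B : {set gT}) : #|Comm 0 B| = 1%N.
  suff -> : Comm 0 B = [set: 0.-tuple gT] by rewrite cardsT card_tuple.
  by apply/setP=> t; rewrite in_setT; apply/CommP; split=> -[].
by rewrite card_CommS; under eq_bigr => x _ do rewrite Comm0; rewrite sum1_card.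
Qed.

(** Both sides count the pairs [(x, y)] with [y] fixed under conjugation by [x]:
    by the first entry, and by Burnside's lemma over the orbits of [G] on
    itself, which are its conjugacy classes. *)
Lemma card_Comm2 G : #|Comm 2 G| = (#|G| * #|classes G|)%N.
Proof.
rewrite card_CommS; under eq_bigr => x _ do rewrite card_Comm1.
have actsG : [acts G, on G | 'J] by rewrite astabsJ normG.
rewrite mulnC -[classes G]/(orbit 'J G @: G) -(Frobenius_Cauchy actsG).
by apply: eq_bigr => x _; rewrite afixJ cent_set1.
Qed.

Lemma tnth_n_act r (t : r.-tuple gT) x i :
  tnth (('J * r)%act t x) i = tnth t i ^ x.
Proof. by rewrite tnth_map. Qed.

Lemma acts_Comm r G : [acts G, on Comm r G | 'J * r].
Proof.
apply/subsetP=> x Gx; rewrite !inE; apply/subsetP=> t /CommP[tG tC].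
rewrite inE; apply/CommP; split=> [i | i j]; rewrite !tnth_n_act ?groupJ //.
by rewrite /commute -!conjMg tC.
Qed.

Lemma afix_Comm r A x : 'Fix_(Comm r A | 'J * r)[x] = Comm r 'C_A[x].
Proof.
apply/setP=> t; rewrite inE; apply/andP/CommP => [[/CommP[tA tC] /afix1P tx] | [tA tC]].
  split=> // i; rewrite inE tA; apply/cent1P/commgP/conjg_fixP.
  by rewrite -tnth_n_act tx.
split; first by apply/CommP; split=> // i; case/setIP: (tA i).
apply/afix1P/eq_from_tnth => i; rewrite tnth_n_act.
by case/setIP: (tA i) => _ /cent1P/commgP/conjg_fixP.
Qed.

(** Burnside's lemma, its fixed-point count being the first-entry count of
    commuting tuples with one more entry. *)
Lemma card_Comm_kappa r G : #|Comm r.+1 G| = (kappa r G * #|G|)%N.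
Proof.
rewrite card_CommS -(Frobenius_Cauchy (acts_Comm r G)).
by apply: eq_bigr => x _; rewrite afix_Comm.
Qed.

Lemma cent1_conj_class G x y :
  y \in x ^: G -> exists2 g, g \in G & 'C_G[y] = 'C_G[x] :^ g.
Proof. by case/imsetP=> g Gg ->; exists g; rewrite // conjIg cent1J conjGid. Qed.

Lemma sum_class_fun G (F : gT -> nat) (rep : {set gT} -> gT) :
    (forall K, K \in classes G -> rep K \in K) ->
    {in G &, forall x g, F (x ^ g) = F x} ->
  (\sum_(x in G) F x = \sum_(K in classes G) #|K| * F (rep K))%N.
Proof.
move=> repK FJ; rewrite (set_partition_big _ (classes_partition G)) /=.
apply: eq_bigr => K clK; rewrite -sum_nat_const; apply: eq_bigr => x Kx.
have := repK K clK; case/imsetP: clK Kx => y Gy -> /imsetP[g Gg ->].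
by case/imsetP=> h Gh ->; rewrite !FJ.
Qed.

(** Centralizers of conjugate elements are conjugate, so [#|Comm 2 'C_G[x]|] is
    a class function of [x]; orbit-stabilizer then trades [#|K|] times the order
    of the centralizer for [#|G|]. *)
Lemma card_Comm3_classes G (rep : {set gT} -> gT) :
    (forall K, K \in classes G -> rep K \in K) ->
  #|Comm 3 G| = (#|G| * \sum_(K in classes G) #|classes 'C_G[rep K]|)%N.
Proof.
move=> repK; rewrite card_CommS big_distrr /=.
rewrite (sum_class_fun repK) => [|x g Gx Gg]; last first.
  have [|h _ ->] := @cent1_conj_class G x (x ^ g); first exact: imset_f.
  by rewrite !card_Comm2 cardJg -(nclasses_isog (conj_isog 'C_G[x] h)).
apply: eq_bigr => K clK; rewrite card_Comm2 mulnA; congr (_ * _)%N.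
have defK : K = rep K ^: G.
  by have := repK K clK; case/imsetP: clK => x _ -> /class_eqP.
by rewrite {1}defK -index_cent1 mulnC Lagrange ?subsetIl.
Qed.

End CommutingTuples.

Local Open Scope ring_scope.

(* [rep] is an arbitrary choice of a representative in each conjugacy class. *)
Theorem theorem4p1 (gT : finGroupType) (G : {group gT})
    (rep : {set gT} -> gT) (hrep : forall K, K \in classes G -> rep K \in K) :
  [/\ comm_prob 3 G =
        1 / #|G|%:R ^+ 3 *
        \sum_(x in G) #|'C_G[x]|%:R * #|classes 'C_G[x]|%:R,
      comm_prob 3 G =
        1 / #|G|%:R ^+ 2 * \sum_(K in classes G) #|classes 'C_G[rep K]|%:R,
      #|G|%:R ^+ 2 * comm_prob 3 G = (kappa 2 G)%:R
    & kappa 2 G = (\sum_(K in classes G) #|classes 'C_G[rep K]|)%N].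
Proof.
have G0 : #|G|%:R != 0 :> rat by rewrite Num.Theory.pnatr_eq0 -lt0n cardG_gt0.
have G2 : #|G|%:R ^+ 2 != 0 :> rat by rewrite expf_neq0.
have defK : kappa 2 G = (\sum_(K in classes G) #|classes 'C_G[rep K]|)%N.
  apply/eqP; rewrite -(eqn_pmul2r (cardG_gt0 G)) -card_Comm_kappa mulnC.
  by rewrite (card_Comm3_classes hrep).
have P3 : comm_prob 3 G = (kappa 2 G)%:R / #|G|%:R ^+ 2.
  by rewrite /comm_prob card_Comm_kappa natrM exprSr -mulf_div divff // mulr1.
split=> //.
- rewrite /comm_prob mulrC div1r card_CommS natr_sum; congr (_ * _).
  by apply: eq_bigr => x _; rewrite card_Comm2 natrM.
- by rewrite P3 defK natr_sum div1r mulrC.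
- by rewrite P3 mulrC divfK.
Qed.
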